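(* Let $\varepsilon>0$. Let $G$ and $\xi$ be independent normally distributed random variables with positive variances such that $\mathrm{Var}(\xi)/\mathrm{Var}(G)=\varepsilon^2$, and let $M=G+\xi$. Then, as $\alpha\to0^+$, $$\rho_\alpha\sim\frac{1}{\varepsilon\sqrt{2\ln\frac1\alpha-\ln\ln\frac1{\alpha^2}-\ln\tau}},$$ where $\tau=2\pi$. In particular, $\rho_\alpha\to0$ as $\alpha\to0$.
   Context: For $\alpha\in(0,1)$, $m_\alpha$ denotes the top-$\alpha$ quantile of $M$, i.e. $\mathbb P[M\ge m_\alpha]=\alpha$. A subscript $\alpha$ denotes conditioning on the event $M\ge m_\alpha$: $\mathbb E_\alpha[X]=\mathbb E[X\mid M\ge m_\alpha]$, and $\mathrm{Var}_\alpha$, $\mathrm{Cov}_\alpha$ are the corresponding conditional variance and covariance. The correlation among the top-$\alpha$ values of $M$ is $\rho_\alpha=\mathrm{Cov}_\alpha(G,M)/\sqrt{\mathrm{Var}_\alpha(G)\,\mathrm{Var}_\alpha(M)}$. $f\sim g$ means $f/g\to1$. *)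

(* Defs.v *)
From HB Require Import structures.
From mathcomp Require Import all_boot all_order all_algebra.
From mathcomp Require Import all_classical all_reals all_analysis.

Set Implicit Arguments.
Unset Strict Implicit.
Unset Printing Implicit Defensive.

Import Order.TTheory GRing.Theory Num.Theory.
Import numFieldNormedType.Exports.

Local Open Scope classical_set_scope.
Local Open Scope ring_scope.

(* Nondegenerate normal law.  [normal_prob m s] is N(m, s^2), except that for
   s = 0 the library gives the uniform law on [0, 1] by convention, hence
   [0 < s].  The laws are only compared on measurable sets because the values
   of a measure elsewhere are unspecified. *)
Definition normally_distributed (R : realType) (d : measure_display)
    (T : measurableType d) (P : probability T R) (X : {RV P >-> R}) : Prop :=
  exists m s : R, 0 < s /\
    forall A : set R, measurable A -> distribution P X A = normal_prob m s A.

Definition independent_RV2 (R : realType) (d : measure_display)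
    (T : measurableType d) (P : probability T R) (X Y : {RV P >-> R}) : Prop :=
  forall A B : set R, measurable A -> measurable B ->
    P ((X @^-1` A) `&` (Y @^-1` B)) = (P (X @^-1` A) * P (Y @^-1` B))%E.

(* P[ . | A] : the restriction of P to A, renormalized; the last argument of
   [mnormalize] is only the default value used when P A = 0. *)
Definition cond_probability (R : realType) (d : measure_display)
    (T : measurableType d) (P : probability T R) (A : set T)
    (mA : measurable A) : probability T R :=
  mnormalize (mrestr P mA) P.

Lemma measurable_upper_tail (R : realType) (d : measure_display)
    (T : measurableType d) (P : probability T R) (M : {RV P >-> R}) (t : R) :
  measurable [set w | t <= M w].
Proof.
rewrite (_ : [set w | t <= M w] = M @^-1` `[t, +oo[).
  exact: measurable_funPTI.
by apply/seteqP; split=> w /=; rewrite in_itv/= andbT.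
Qed.

Definition tail_probability (R : realType) (d : measure_display)
    (T : measurableType d) (P : probability T R) (M : {RV P >-> R}) (t : R) :
    probability T R :=
  cond_probability P (measurable_upper_tail M t).

Definition correlation (R : realType) (d : measure_display)
    (T : measurableType d) (P : probability T R) (X Y : T -> R) : R :=
  fine (covariance P X Y) / Num.sqrt (fine 'V_P[X] * fine 'V_P[Y]).

(* [m] sends each alpha in ]0, 1[ to the top-alpha quantile of [M]; its values
   outside ]0, 1[ are unconstrained. *)
Definition top_quantile (R : realType) (d : measure_display)
    (T : measurableType d) (P : probability T R) (M : {RV P >-> R})
    (m : R -> R) : Prop :=
  forall alpha : R, 0 < alpha < 1 -> P [set w | m alpha <= M w] = alpha%:E.

Arguments normally_distributed {R d T} P X.
Arguments independent_RV2 {R d T} P X Y.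
Arguments tail_probability {R d T} P M t.
Arguments top_quantile {R d T} P M m.

(* Main.v *)
Require Import Defs.
From HB Require Import structures.
From mathcomp Require Import all_boot all_order all_algebra.
From mathcomp Require Import all_classical all_reals all_analysis.
From mathcomp Require Import measurable_realfun ring lra.
Set Implicit Arguments.
Unset Strict Implicit.
Unset Printing Implicit Defensive.

Import Order.TTheory GRing.Theory Num.Theory.
Import numFieldNormedType.Exports.
Local Open Scope classical_set_scope.
Local Open Scope ring_scope.

(** Write [G = a + s1 Z1] and [xi = b + s2 Z2] with [Z1], [Z2] independent
standard normals.  A rotation of [(Z1, Z2)] gives independent standard normals
[U], [V] such that [M] is an affine function of [U] alone and
[G = a + s1 c U + s1 e V] with [e / c = eps].  Conditioning on [M >= m_alpha]
is conditioning on [U >= t]; it changes neither the law of [V] nor its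
independence from [U], so the correlation is [sqrt v / sqrt (v + eps^2)], where
[v = 1 + t h - h^2], [h = phi t / Q t], is the variance of a standard normal
conditioned to exceed [t] ([phi] the density, [Q] the tail).  Three terms of the
asymptotic expansion of [Q t / phi t] give [v ~ t^-2], and [Q t = alpha] gives
[t^2 ~ 2 ln (1 / alpha)]; the lower-order terms of the expansion in [alpha] do
not matter for the equivalence. *)

(** Three terms are needed because [v] is the result of a near cancellation. With
    [p = t Q t / phi t] one has [h = t / p], and in [v t^2 p^2 = t^4 (p^2 t^-2 + p - 1)] the
    contributions of order [t^4] and [t^2] both vanish. What remains is the [t^-4] coefficient 3 of
    [p], lowered by the 2 coming from [p^2], so the limit is [3 - 2 = 1]. The analysis is done in
    the variable [t -> +oo] with [Q t] in place of [alpha], and its results are composed with the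
    standardized quantile [t(alpha)]. The function [Q] is never inverted: [Q (t(alpha)) = alpha],
    monotonicity and positivity of [Q] are enough. Independence speaks of rectangles only. The joint
    law is therefore identified with the product of the marginal laws, which opens the way to
    Tonelli for the rotation and to Fubini for the expectation of a product. *)

(** * Integration against normal laws and standardization *)

(** The image of [a] times Lebesgue measure under [x |-> a x + b] agrees with Lebesgue measure on
    half-open intervals, so uniqueness identifies the two. *)
Lemma ge0_integral_affine (R : realType) (a b : R) (f : R -> \bar R) :
  0 < a -> measurable_fun [set: R] f -> (forall x, (0 <= f x)%E) ->
  (\int[@lebesgue_measure R]_x f x =
   a%:E * \int[@lebesgue_measure R]_x f (a * x + b)%R)%E.
Proof.
move=> a0 mf f0.
pose g : measurableTypeR R -> measurableTypeR R := fun x => a * x + b.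
have mg : measurable_fun [set: measurableTypeR R] g.
  by apply: measurable_funD => //; exact: measurable_funM.
pose k : {nonneg R} := NngNum (ltW a0).
have pushE (A : set R) : measurable A ->
    pushforward (mscale k lebesgue_measure) g A = lebesgue_measure A.
  move=> mA; apply/esym/lebesgue_measure_unique => //= _ [[c d]] _ <-.
  rewrite /pushforward /= /mscale /=.
  have -> : g @^-1` `]c, d] = `](c - b) / a, (d - b) / a]%classic.
    apply/seteqP; split => x /=;
      by rewrite !in_itv/= /g ltr_pdivrMr// ler_pdivlMr// ltrBlDr lerBrDr (mulrC x).
  rewrite !lebesgue_measure_itv/= !lte_fin.
  rewrite ltr_pM2r ?invr_gt0// ltrD2r; case: ifPn => _; last by rewrite mule0.
  by rewrite -!EFinB -EFinM; congr EFin; field; rewrite gt_eqF.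
transitivity (\int[mscale k lebesgue_measure]_x (f \o g) x)%E; last first.
  rewrite ge0_integral_mscale//; first exact: (measurableT_comp mf mg).
  by move=> x _; exact: f0.
have := @ge0_integral_pushforward _ _ _ _ R g mg (mscale k lebesgue_measure)
  setT f measurableT mf (fun y _ => f0 y).
rewrite preimage_setT => <-.
by apply: eq_measure_integral => A mA _; rewrite /= pushE.
Qed.

(** The Radon-Nikodym derivative of the normal law and [normal_pdf] have the same integral over
    every measurable set, hence agree almost everywhere and can be exchanged under the integral. *)
Lemma ge0_integral_normal_prob (R : realType) (m s : R) (f : R -> \bar R)
    (D : set R) :
  measurable D -> measurable_fun [set: R] f -> (forall x, (0 <= f x)%E) ->
  (\int[normal_prob m s]_(x in D) f x =
   \int[lebesgue_measure]_(x in D) (f x * (normal_pdf m s x)%:E))%E.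
Proof.
move=> mD mf f0.
have dom := @normal_prob_dominates R m s.
rewrite -(Radon_Nikodym_SigmaFinite.change_of_variables dom)//; last first.
  exact: measurable_funTS.
have mh : measurable_fun D
    (Radon_Nikodym_SigmaFinite.f (normal_prob m s) lebesgue_measure).
  apply: measurable_funTS.
  exact: measurable_int (Radon_Nikodym_SigmaFinite.f_integrable dom).
have mp : measurable_fun D (fun x => (normal_pdf m s x)%:E).
  by apply: measurable_funTS; apply/measurable_EFinP; exact: measurable_normal_pdf.
have mf' : measurable_fun D f by exact: measurable_funTS.
apply: ae_eq_integral => //; [exact: emeasurable_funM..|].
apply: ae_eqe_mul2l; apply: integral_ae_eq => //.
  apply: (integrableS measurableT) => //.
  exact: Radon_Nikodym_SigmaFinite.f_integrable.
by move=> A _ mA; rewrite -Radon_Nikodym_SigmaFinite.f_integral.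
Qed.

Definition standard_normal (R : realType) d (T : measurableType d)
    (P : probability T R) (X : {RV P >-> R}) :=
  forall A : set R, measurable A -> distribution P X A = normal_prob 0 1 A.
Arguments standard_normal {R d T} P X.

Lemma exists_mfun (R : realType) d (T : measurableType d) (f : T -> R) :
  measurable_fun [set: T] f -> exists X : {mfun T >-> R}, X = f :> (T -> R).
Proof.
move=> mf; pose X : {mfun T >-> R} := HB.pack f (isMeasurableFun.Build _ _ _ _ _ mf).
by exists X.
Qed.

Lemma normal_pdf_scale (R : realType) (m s z : R) : 0 < s ->
  s * normal_pdf m s (s * z + m) = normal_pdf 0 1 z.
Proof.
move=> s0; rewrite !normal_pdfE ?oner_eq0 ?gt_eqF//.
have -> : normal_fun m s (s * z + m) = normal_fun 0 1 z.
  by rewrite /normal_fun; congr expR; field; rewrite gt_eqF.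
rewrite mulrA; congr (_ * _).
rewrite /normal_peak -!mulrnAr sqrtrM ?sqr_ge0// sqrtr_sqr gtr0_norm//.
by rewrite invfM mulrA divff ?gt_eqF// expr1n !mul1r.
Qed.

Lemma normal_pdf_std_expE (R : realType) (x : R) :
  normal_pdf 0 1 x = normal_peak 1 * expR (- x ^+ 2 / 2).
Proof.
rewrite normal_pdfE ?oner_eq0// /normal_fun; congr (_ * expR _).
by rewrite subr0 expr1n.
Qed.

Lemma normal_prob_indicE (R : realType) (m s : R) (A : set R) : measurable A ->
  normal_prob m s A =
  (\int[@lebesgue_measure R]_x ((\1_A x)%:E * (normal_pdf m s x)%:E))%E.
Proof.
move=> mA; rewrite /normal_prob integral_mkcond; apply: eq_integral => x _.
by rewrite epatch_indic muleC.
Qed.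

Lemma normal_prob_standardize (R : realType) (m s : R) (A : set R) :
  0 < s -> measurable A ->
  normal_prob m s ((fun x => (x - m) / s) @^-1` A) = normal_prob 0 1 A.
Proof.
move=> s0 mA.
have mg : measurable_fun [set: R] (fun x : R => (x - m) / s).
  by apply: measurable_funM => //; exact: measurable_funB.
have mA' : measurable ((fun x => (x - m) / s) @^-1` A).
  by rewrite -[X in measurable X]setTI; exact: mg.
have ms : measurable_fun [set: R] (fun x : R => s * x + m).
  by apply: measurable_funD => //; exact: measurable_funM.
rewrite !normal_prob_indicE// (@ge0_integral_affine R s m)//; last 2 first.
- apply: emeasurable_funM; apply/measurable_EFinP; first exact: measurable_indic.
  exact: measurable_normal_pdf.
- by move=> x; rewrite -EFinM lee_fin mulr_ge0// normal_pdf_ge0.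
rewrite -ge0_integralZl//; last 3 first.
- apply: emeasurable_funM; apply/measurable_EFinP.
    by apply: (measurableT_comp _ ms); exact: measurable_indic.
  by apply: (measurableT_comp _ ms); exact: measurable_normal_pdf.
- by move=> x _; rewrite -EFinM lee_fin mulr_ge0// normal_pdf_ge0.
- by rewrite lee_fin ltW.
apply: eq_integral => x _; rewrite -!EFinM -(normal_pdf_scale m _ s0)// mulrCA.
congr (_ * _)%:E; rewrite !indicE; congr (nat_of_bool _)%:R.
by apply/idP/idP; rewrite !inE/= addrK mulrAC divff ?gt_eqF// mul1r.
Qed.

Lemma normally_distributed_standardize (R : realType) d (T : measurableType d)
    (P : probability T R) (X : {RV P >-> R}) : normally_distributed P X ->
  exists m s (Z : {RV P >-> R}),
    [/\ 0 < s, standard_normal P Z & forall w, X w = m + s * Z w].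
Proof.
move=> [m [s [s0 XE]]].
have mZ : measurable_fun [set: T] (fun w => (X w - m) / s).
  by apply: measurable_funM => //; exact: measurable_funB.
have [Z ZE] := exists_mfun mZ.
exists m, s, Z; split => // [A mA|w]; last first.
  by rewrite ZE mulrCA mulfV ?gt_eqF// mulr1 addrC subrK.
rewrite -(normal_prob_standardize m s0 mA) -XE /distribution /pushforward.
  by rewrite ZE.
have mg : measurable_fun [set: R] (fun x : R => (x - m) / s).
  by apply: measurable_funM => //; exact: measurable_funB.
by rewrite -[X in measurable X]setTI; exact: mg.
Qed.

(** * Joint laws, rotation of Gaussian pairs, products of independent variables *)

Lemma independent_pair_law (R : realType) d (T : measurableType d)
    (P : probability T R) (X Y : {RV P >-> R}) : independent_RV2 P X Y ->
  forall S : set (R * R), measurable S ->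
  P ((fun w => (X w, Y w)) @^-1` S) = (distribution P X \x distribution P Y)%E S.
Proof.
move=> ind S mS.
have mXY : measurable_fun [set: T] (fun w => (X w, Y w)).
  exact: measurable_fun_pair.
apply/esym.
apply: (@product_measure_unique _ _ _ _ R (distribution P X) (distribution P Y)
  (pushforward P (fun w => (X w, Y w)))) => //= A B mA mB.
Qed.

Lemma std_normal_pdf_rotation (R : realType) (c e u v : R) :
  c ^+ 2 + e ^+ 2 = 1 ->
  normal_pdf 0 1 (e * u - c * v) * normal_pdf 0 1 (c * u + e * v) =
  normal_pdf 0 1 u * normal_pdf 0 1 v.
Proof.
move=> ce; rewrite !normal_pdf_std_expE !mulrA.
rewrite ![normal_peak 1 * expR _]mulrC -!mulrA; rewrite ![expR _ * (_ * _)]mulrCA !mulrA.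
rewrite -!mulrA -!expRD; congr (_ * (_ * expR _)).
rewrite !mulNr -!opprD -!mulrDl; congr (- (_ / _)).
transitivity ((c ^+ 2 + e ^+ 2) * (u ^+ 2 + v ^+ 2)); first by ring.
by rewrite ce mul1r.
Qed.

(* Substitute y = (u - c x) / e, swap the integrals, then substitute
   x = e v + c u; the two Jacobians cancel. *)
Lemma product_std_normal_rotation (R : realType) (c e : R) (A B : set R) :
  c ^+ 2 + e ^+ 2 = 1 -> 0 < e -> measurable A -> measurable B ->
  (normal_prob 0 1 \x normal_prob 0 1)%E
    [set z : R * R | A (c * z.1 + e * z.2) /\ B (e * z.1 - c * z.2)] =
  (normal_prob 0 1 A * normal_prob 0 1 B)%E.
Proof.
move=> ce e0 mA mB.
set S := [set z | _].
have m1 : measurable_fun [set: R * R] (fun z : R * R => c * z.1 + e * z.2).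
  by apply: measurable_funD; apply: measurable_funM => //.
have m2 : measurable_fun [set: R * R] (fun z : R * R => e * z.1 - c * z.2).
  by apply: measurable_funB; apply: measurable_funM => //.
have mS : measurable S.
  rewrite (_ : S = (fun z : R * R => c * z.1 + e * z.2) @^-1` A `&`
                   (fun z : R * R => e * z.1 - c * z.2) @^-1` B)//.
  apply: measurableI; rewrite -[X in measurable X]setTI; [exact: m1|exact: m2].
pose p : R -> R := normal_pdf 0 1.
have mp : measurable_fun [set: R] p by exact: measurable_normal_pdf.
have p0 x : 0 <= p x by exact: normal_pdf_ge0.
have enz : e != 0 by rewrite gt_eqF.
(* Integrand in [(x, u)] once [u = c x + e y] has replaced [y]; the factor [e^-1] is the
   Jacobian. *)
pose q (z : R * R) : \bar R :=
  ((e^-1 * (\1_A z.2 * \1_B ((z.1 - c * z.2) / e)) *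
    (p ((z.2 - c * z.1) / e) * p z.1))%:E)%E.
have q0 z : (0 <= q z)%E by rewrite lee_fin !mulr_ge0// invr_ge0 ltW.
have mdiff (i j : R * R -> R) : measurable_fun setT i -> measurable_fun setT j ->
    measurable_fun setT (fun z => (i z - c * j z) / e).
  move=> mi mj; apply: measurable_funM => //.
  by apply: measurable_funB => //; exact: measurable_funM.
have mq : measurable_fun [set: R * R] q.
  apply/measurable_EFinP; apply: measurable_funM.
    apply: measurable_funM => //; apply: measurable_funM.
  - by apply: (measurableT_comp (measurable_indic mA)).
  - by apply: (measurableT_comp (measurable_indic mB)); exact: mdiff.
  - apply: measurable_funM.
      by apply: (measurableT_comp mp); exact: mdiff.
    exact: (measurableT_comp mp).
have mxS x : measurable (xsection S x) by exact: measurable_xsection.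
transitivity (\int[normal_prob 0 1]_x (normal_prob 0 1 (xsection S x)))%E => //.
rewrite ge0_integral_normal_prob//; last exact: measurable_fun_xsection.
transitivity (\int[@lebesgue_measure R]_x \int[@lebesgue_measure R]_u q (x, u))%E.
  apply: eq_integral => x _.
  rewrite normal_prob_indicE//.
  rewrite (@ge0_integral_affine R e^-1 (- c * x / e))//; last 3 first.
  - by rewrite invr_gt0.
  - by apply: emeasurable_funM; apply/measurable_EFinP.
  - by move=> y; rewrite -EFinM lee_fin mulr_ge0.
  have mx : measurable_fun [set: R] (fun u => e^-1 * u + - c * x / e).
    by apply: measurable_funD => //; exact: measurable_funM.
  rewrite -ge0_integralZl//; last 3 first.
  - apply: emeasurable_funM; apply/measurable_EFinP.
      by apply: (measurableT_comp _ mx); exact: measurable_indic.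
    exact: (measurableT_comp mp mx).
  - by move=> y _; rewrite -EFinM lee_fin mulr_ge0.
  - by rewrite lee_fin invr_ge0 ltW.
  rewrite -ge0_integralZr//; last 3 first.
  - apply: emeasurable_funM => //; apply: emeasurable_funM; apply/measurable_EFinP.
      by apply: (measurableT_comp _ mx); exact: measurable_indic.
    exact: (measurableT_comp mp mx).
  - by move=> y _; rewrite -!EFinM lee_fin !mulr_ge0// invr_ge0 ltW.
  - by rewrite lee_fin.
  apply: eq_integral => u _; rewrite -!EFinM /q/= -/p.
  have -> : e^-1 * u + - c * x / e = (u - c * x) / e by field.
  set y := (u - c * x) / e.
  have uE : u = c * x + e * y by rewrite /y; field.
  (* Expressed in [x] and [u], the second form is [(x - c u) / e], exactly the variable [v] of the
     second substitution. *)
  have yE : (x - c * u) / e = e * x - c * y.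
    transitivity (((c ^+ 2 + e ^+ 2) * x - c * u) / e); first by rewrite ce mul1r.
    by rewrite /y; field.
  have -> : \1_(xsection S x) y = \1_A u * \1_B ((x - c * u) / e) :> R.
    rewrite !indicE mem_xsection -natrM mulnb; congr (nat_of_bool _)%:R.
    by rewrite yE [in RHS]uE; apply/idP/andP; rewrite !inE.
  by congr EFin; ring.
rewrite (@fubini_tonelli _ _ _ _ R lebesgue_measure lebesgue_measure q mq q0).
rewrite [normal_prob 0 1 A]normal_prob_indicE// -ge0_integralZr//; last 2 first.
- by apply: emeasurable_funM; apply/measurable_EFinP.
- by move=> y _; rewrite -!EFinM lee_fin !mulr_ge0.
apply: eq_integral => u _.
have mqu : measurable_fun [set: R] (fun x => q (x, u)).
  by apply: (measurableT_comp mq); exact: measurable_fun_pair.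
have mev : measurable_fun [set: R] (fun x => e * x + c * u).
  by apply: measurable_funD => //; exact: measurable_funM.
rewrite (@ge0_integral_affine R e (c * u))//.
rewrite normal_prob_indicE// -[LHS]ge0_integralZl//; last 2 first.
- exact: (measurableT_comp mqu mev).
- by rewrite lee_fin ltW.
rewrite -[RHS]ge0_integralZl//; last 3 first.
- by apply: emeasurable_funM; apply/measurable_EFinP.
- by move=> y _; rewrite -!EFinM lee_fin !mulr_ge0.
- by rewrite -!EFinM lee_fin !mulr_ge0.
apply: eq_integral => v _; rewrite /q /= -!EFinM; congr EFin.
rewrite addrK [e * v]mulrC mulfK// [v * e]mulrC.
have -> : (u - c * (e * v + c * u)) / e = e * u - c * v.
  transitivity (((c ^+ 2 + e ^+ 2) * u - c * (e * v + c * u)) / e).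
    by rewrite ce mul1r.
  by field.
rewrite [e * v + _]addrC std_normal_pdf_rotation//.
by field.
Qed.

Lemma ge0_integral_standard_normal (R : realType) d (T : measurableType d)
    (P : probability T R) (X : {RV P >-> R}) (f : R -> \bar R) :
  standard_normal P X -> measurable_fun [set: R] f -> (forall x, (0 <= f x)%E) ->
  (\int[P]_w f (X w) = \int[normal_prob 0 1]_x f x)%E.
Proof.
move=> nX mf f0.
have mX : measurable_fun [set: T] (X : T -> measurableTypeR R).
  exact: (@measurable_funPT _ _ _ _ X).
pose X' : {mfun T >-> measurableTypeR R} :=
  HB.pack (X : T -> measurableTypeR R) (isMeasurableFun.Build _ _ _ _ _ mX).
transitivity (\int[distribution P X']_x f x)%E.
  by rewrite ge0_integral_distribution.
by apply: eq_measure_integral => A mA _; exact: nX.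
Qed.

(** The matrix with rows [(c, e)] and [(e, -c)] is symmetric and orthogonal, so it is its own
    inverse: the same formulas later recover [X] and [Y] from [U] and [V]. The marginal laws are the
    joint formula with one of the sets taken to be the whole line. *)
Lemma std_normal_rotation (R : realType) d (T : measurableType d)
    (P : probability T R) (X Y U V : {RV P >-> R}) (c e : R) :
  c ^+ 2 + e ^+ 2 = 1 -> 0 < e ->
  standard_normal P X -> standard_normal P Y -> independent_RV2 P X Y ->
  (forall w, U w = c * X w + e * Y w) -> (forall w, V w = e * X w - c * Y w) ->
  [/\ standard_normal P U, standard_normal P V & independent_RV2 P U V].
Proof.
move=> ce e0 nX nY ind UE VE.
have joint A B : measurable A -> measurable B ->
    P ((U @^-1` A) `&` (V @^-1` B)) = (normal_prob 0 1 A * normal_prob 0 1 B)%E.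
  move=> mA mB.
  rewrite -(product_std_normal_rotation ce e0 mA mB).
  rewrite (_ : _ `&` _ = (fun w => (X w, Y w)) @^-1`
      [set z : R * R | A (c * z.1 + e * z.2) /\ B (e * z.1 - c * z.2)]); last first.
    by apply/seteqP; split => w /=; rewrite -UE -VE.
  have mS : measurable
      [set z : R * R | A (c * z.1 + e * z.2) /\ B (e * z.1 - c * z.2)].
    rewrite (_ : mkset _ = (fun z : R * R => c * z.1 + e * z.2) @^-1` A `&`
                     (fun z : R * R => e * z.1 - c * z.2) @^-1` B)//.
    have m1 : measurable_fun [set: R * R] (fun z : R * R => c * z.1 + e * z.2).
      by apply: measurable_funD; apply: measurable_funM => //.
    have m2 : measurable_fun [set: R * R] (fun z : R * R => e * z.1 - c * z.2).
      by apply: measurable_funB; apply: measurable_funM => //.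
    apply: measurableI; rewrite -[X in measurable X]setTI; [exact: m1|exact: m2].
  rewrite independent_pair_law//.
  set S := [set z | _] in mS *.
  have mxS x : measurable (xsection S x) by exact: measurable_xsection.
  have mF : measurable_fun [set: R] (fun x => normal_prob 0 1 (xsection S x)).
    exact: measurable_fun_xsection.
  transitivity (\int[distribution P X]_x distribution P Y (xsection S x))%E => //.
  transitivity (\int[distribution P X]_x (normal_prob 0 1 (xsection S x)))%E.
    by apply: eq_integral => x _; exact: nY.
  by rewrite ge0_integral_distribution//= (ge0_integral_standard_normal nX mF).
have nU : standard_normal P U.
  move=> A mA; have := joint A setT mA measurableT.
  by rewrite preimage_setT setIT probability_setT mule1.
have nV : standard_normal P V.
  move=> B mB; have := joint setT B measurableT mB.
  by rewrite preimage_setT setTI probability_setT mul1e.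
split => // A B mA mB; rewrite joint//.
by congr (_ * _)%E; [rewrite -nU | rewrite -nV].
Qed.

(** The integrand [z.1 * z.2] is signed, so Fubini on the product of the laws needs integrability
    there; it is transported from that of [X \* Y] under [P] through the joint law. *)
Lemma expectationM_independent (R : realType) d (T : measurableType d)
    (P : probability T R) (X Y : {RV P >-> R}) : independent_RV2 P X Y ->
  (X : T -> R) \in Lfun P 1 -> (Y : T -> R) \in Lfun P 1 ->
  (X \* Y)%R \in Lfun P 1 -> ('E_P[X \* Y] = 'E_P[X] * 'E_P[Y])%E.
Proof.
move=> ind X1 Y1 XY1; rewrite unlock.
have mXY : measurable_fun [set: T] (fun w => (X w, Y w)).
  exact: measurable_fun_pair.
have [Z ZE] : exists Z : {mfun T >-> (R * R)%type}, Z = (fun w => (X w, Y w)) :> (T -> R * R).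
  pose Z : {mfun T >-> (R * R)%type} :=
    HB.pack (fun w => (X w, Y w)) (isMeasurableFun.Build _ _ _ _ _ mXY).
  by exists Z.
pose f (z : R * R) := (z.1 * z.2)%:E.
have mf : measurable_fun [set: R * R] f.
  by apply/measurable_EFinP; exact: measurable_funM.
have fZ : f \o Z = EFin \o (X \* Y) by apply/funext => w /=; rewrite ZE.
have ifZ : P.-integrable setT (f \o Z) by rewrite fZ; exact/Lfun1_integrable.
have jointE S : measurable S ->
    (distribution P X \x distribution P Y)%E S = distribution P Z S.
  by move=> mS; rewrite -independent_pair_law// /distribution /pushforward ZE.
have intf : (distribution P X \x distribution P Y)%E.-integrable setT f.
  have /integrableP[_ fy] :=
    integrable_pushforward (@measurable_funPT _ _ _ _ Z) mf ifZ measurableT.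
  apply/integrableP; split => //; apply: le_lt_trans fy.
  rewrite le_eqVlt; apply/orP; left; apply/eqP.
  by apply: eq_measure_integral => S mS _; exact: jointE.
transitivity (\int[distribution P Z]_z f z)%E.
  by rewrite integral_distribution// fZ.
transitivity (\int[(distribution P X \x distribution P Y)%E]_z f z)%E.
  by apply: eq_measure_integral => S mS _; rewrite /= jointE.
rewrite -integral12_prod_meas1//.
have iY : P.-integrable setT (EFin \o Y) by exact/Lfun1_integrable.
have iX : P.-integrable setT (EFin \o X) by exact/Lfun1_integrable.
have iidY : (distribution P Y).-integrable setT (EFin : R -> \bar R).
  exact: integrable_pushforward.
transitivity (\int[distribution P X]_x (x%:E * \int[P]_w (Y w)%:E))%E.
  apply: eq_integral => x _; rewrite /fubini_F /f /=.
  under eq_integral do rewrite EFinM.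
  rewrite integralZl//; congr (_ * _)%E.
  by rewrite integral_distribution.
rewrite -(fineK (integrable_fin_num measurableT iY)).
rewrite integralZr//; last exact: integrable_pushforward.
by rewrite integral_distribution.
Qed.

(** * The Gaussian density and its tail integrals *)

Lemma is_derive_std_normal_pdf (R : realType) (x : R) :
  is_derive x 1 (normal_pdf 0 1) (- x * normal_pdf 0 1 x).
Proof.
have -> : normal_pdf 0 1 =
    (normal_peak 1 *: (expR \o (fun y : R => (- 2^-1) * y ^+ 2)) : R -> R).
  apply/funext => y; rewrite normal_pdf_std_expE/=.
  by congr (_ * expR _); rewrite mulrC mulrN mulNr.
have h : is_derive x 1 (fun y : R => (- 2^-1) * y ^+ 2) (- x).
  have -> : (fun y : R => (- 2^-1) * y ^+ 2) = (- 2^-1) *: ((id : R -> R) ^+ 2).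
    by apply/funext => y.
  apply: is_derive_eq; rewrite expr1 scaler1 -scaler_nat scalerA /GRing.scale/=.
  by rewrite mulNr mulVf// mulN1r.
apply: is_derive_eq; rewrite /GRing.scale/= /GRing.scale/=.
by ring.
Qed.

Lemma std_normal_pdfN (R : realType) (x : R) :
  normal_pdf 0 1 (- x) = normal_pdf 0 1 x.
Proof. by rewrite !normal_pdf_std_expE sqrrN. Qed.

Lemma std_normal_pdf_gt0 (R : realType) (x : R) : 0 < normal_pdf 0 1 x.
Proof.
by rewrite normal_pdf_std_expE mulr_gt0 ?expR_gt0// normal_peak_gt0 ?oner_eq0.
Qed.

Lemma cvg_inv_pinfty (R : realType) : x^-1 @[x --> +oo] --> (0 : R).
Proof. by apply/(@gtr0_cvgV0 R _ _ _ id) => //; exact: nbhs_pinfty_gt. Qed.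

(** The crude bound [expR y >= 1 + y] at [y = x^2 / 2] already gives
    [x phi x <= 2 normal_peak 1 / x]. *)
Lemma mul_std_normal_pdf_cvg0 (R : realType) :
  x * normal_pdf 0 1 x @[x --> +oo] --> (0 : R).
Proof.
have p0 : 0 < normal_peak (1 : R) by rewrite normal_peak_gt0 ?oner_eq0.
apply: (@squeeze_cvgr _ _ _ _ (cst 0) (fun x => 2 * normal_peak 1 * x^-1)).
- near=> x.
  have x0 : 0 < x by near: x; exact: nbhs_pinfty_gt.
  apply/andP; split; first by rewrite mulr_ge0// ltW// std_normal_pdf_gt0.
  rewrite normal_pdf_std_expE mulNr expRN.
  have h : 1 + x ^+ 2 / 2 <= expR (x ^+ 2 / 2) by exact: expR_ge1Dx.
  have := expR_gt0 (x ^+ 2 / 2); set e := expR _ in h * => e0.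
  rewrite -subr_ge0.
  have -> : 2 * normal_peak 1 / x - x * (normal_peak 1 / e) =
      normal_peak 1 * (2 * e - x ^+ 2) / (x * e).
    by field; rewrite !gt_eqF.
  by rewrite divr_ge0 ?mulr_ge0 ?ltW//; lra.
- exact: cvg_cst.
- rewrite -[X in _ --> X](mulr0 (2 * normal_peak 1)); apply: cvgM; first exact: cvg_cst.
  exact: cvg_inv_pinfty.
Unshelve. all: by end_near. Qed.

Lemma std_normal_pdf_cvg0 (R : realType) :
  normal_pdf 0 1 x @[x --> +oo] --> (0 : R).
Proof.
apply: (@squeeze_cvgr _ _ _ _ (cst 0) (fun x => x * normal_pdf 0 1 x)).
- near=> x.
  have x1 : 1 <= x by near: x; exact: nbhs_pinfty_ge.
  by rewrite /= ltW ?std_normal_pdf_gt0//= ler_peMl ?ltW// ?std_normal_pdf_gt0.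
- exact: cvg_cst.
- exact: mul_std_normal_pdf_cvg0.
Unshelve. all: by end_near. Qed.

(* Up to sign, [(x * r x - r' x) * phi x] is the derivative of [r x * phi x]. *)
Section tail_integral.
Variables (R : realType) (r dr : R -> R) (a : R).
Hypothesis rdr : forall x, a <= x -> is_derive x 1 r (dr x).
Hypothesis cdr : forall x, a <= x -> {for x, continuous dr}.
Hypothesis dr_le : forall x, a <= x -> dr x <= x * r x.
Hypothesis r0 : r x * normal_pdf 0 1 x @[x --> +oo] --> (0 : R).

Let f (x : R) : R := (x * r x - dr x) * normal_pdf 0 1 x.

Let within_continuous_f : {within `[a, +oo[, continuous f}.
Proof.
apply: continuous_in_subspaceT => x; rewrite inE/= in_itv/= andbT => ax.
apply: cvgM; last by apply: continuous_normal_pdf; rewrite oner_eq0.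
apply: cvgB; last exact: cdr.
apply: cvgM; first exact: cvg_id.
apply: differentiable_continuous; apply/derivable1_diffP.
by have [] := rdr ax.
Qed.

Let measurable_f : measurable_fun `[a, +oo[ (EFin \o f).
Proof.
by apply/measurable_EFinP; exact: subspace_continuous_measurable_fun.
Qed.

Let measurable_pdf : measurable_fun `[a, +oo[ (fun x : R => (normal_pdf 0 1 x)%:E).
Proof.
by apply: measurable_funTS; apply/measurable_EFinP; exact: measurable_normal_pdf.
Qed.

Lemma integral_std_normal_tail :
  (\int[@lebesgue_measure R]_(x in `[a, +oo[)
     ((x * r x - dr x) * normal_pdf 0 1 x)%:E = (r a * normal_pdf 0 1 a)%:E)%E.
Proof.
have dF x : a <= x ->
    is_derive x 1 (- (r * normal_pdf 0 1) : R -> R) (f x).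
  move=> ax; have := rdr ax => rx; have px := is_derive_std_normal_pdf x.
  by apply: is_derive_eq; rewrite /f /GRing.scale/=; ring.
rewrite (@ge0_continuous_FTC2y _ f (- (r * normal_pdf 0 1)) a 0)//.
- by rewrite -EFinB sub0r opprK.
- by move=> x ax; rewrite mulr_ge0 ?normal_pdf_ge0// subr_ge0 dr_le.
- by rewrite -[X in _ --> X]oppr0; exact: cvgN.
- by move=> x /ltW /dF [].
- apply: cvg_at_right_filter; apply: differentiable_continuous.
  by apply/derivable1_diffP; have [] := dF _ (lexx a).
- move=> x; rewrite in_itv/= andbT => /ltW /dF dFx.
  by rewrite derive1E derive_val.
Qed.

(** Mills' ratio [r = Q / phi] solves [x r - r' = 1] exactly. A supersolution [r] therefore bounds
    the tail from above by [r phi], and in the next lemma a subsolution bounds it from below. *)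
Lemma std_normal_tail_le : (forall x, a <= x -> 1 <= x * r x - dr x) ->
  (normal_prob 0 1 `[a, +oo[ <= (r a * normal_pdf 0 1 a)%:E)%E.
Proof.
move=> h; rewrite -integral_std_normal_tail; apply: ge0_le_integral => //.
- by move=> x _; rewrite lee_fin normal_pdf_ge0.
- move=> x; rewrite /= in_itv/= andbT => ax.
  by rewrite lee_fin ler_peMl ?normal_pdf_ge0// h.
Qed.

Lemma std_normal_tail_ge : (forall x, a <= x -> x * r x - dr x <= 1) ->
  ((r a * normal_pdf 0 1 a)%:E <= normal_prob 0 1 `[a, +oo[)%E.
Proof.
move=> h; rewrite -integral_std_normal_tail; apply: ge0_le_integral => //.
- move=> x; rewrite /= in_itv/= andbT => ax.
  by rewrite lee_fin mulr_ge0 ?normal_pdf_ge0// subr_ge0 dr_le.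
- move=> x; rewrite /= in_itv/= andbT => ax.
  by rewrite lee_fin ler_piMl ?normal_pdf_ge0// h.
Qed.

End tail_integral.

Lemma integral_id_std_normal_tail (R : realType) (a : R) : 0 <= a ->
  (\int[@lebesgue_measure R]_(x in `[a, +oo[) (x * normal_pdf 0 1 x)%:E =
   (normal_pdf 0 1 a)%:E)%E.
Proof.
move=> a0; rewrite -[in RHS](mul1r (normal_pdf 0 1 a)).
rewrite -(@integral_std_normal_tail _ (cst 1) (cst 0)).
- by apply: eq_integral => x _; rewrite mulr1 subr0.
- by move=> x _; exact: cvg_cst.
- by move=> x ax; rewrite mulr1 (le_trans a0).
- by rewrite /= -[X in _ --> X](mul1r 0); apply: cvgM;
    [exact: cvg_cst|exact: std_normal_pdf_cvg0].
Qed.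

(** This is the case [r x = x]. The bound [1 <= a] keeps [x^2 - 1] nonnegative, and is the origin of
    the assumption [1 <= t] on the conditioned moments. *)
Lemma integral_sqrB1_std_normal_tail (R : realType) (a : R) : 1 <= a ->
  (\int[@lebesgue_measure R]_(x in `[a, +oo[) ((x ^+ 2 - 1) * normal_pdf 0 1 x)%:E =
   (a * normal_pdf 0 1 a)%:E)%E.
Proof.
move=> a1; rewrite -(@integral_std_normal_tail _ id (cst 1))//.
- by move=> x _; exact: cvg_cst.
- by move=> x ax; rewrite /= -expr2 expr_ge1// (le_trans _ ax)// (le_trans _ a1).
- exact: mul_std_normal_pdf_cvg0.
Qed.

Lemma integral_sqr_std_normal_tail (R : realType) (a : R) : 1 <= a ->
  (\int[@lebesgue_measure R]_(x in `[a, +oo[) (x ^+ 2 * normal_pdf 0 1 x)%:E =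
   (a * normal_pdf 0 1 a)%:E + normal_prob 0 1 `[a, +oo[)%E.
Proof.
move=> a1; rewrite -integral_sqrB1_std_normal_tail// /normal_prob.
rewrite -ge0_integralD//=.
- by apply: eq_integral => x _; rewrite -EFinD; congr EFin; ring.
- move=> x; rewrite /= in_itv/= andbT => ax.
  by rewrite lee_fin mulr_ge0 ?normal_pdf_ge0//; nra.
- apply/measurable_EFinP; apply: measurable_funTS; apply: measurable_funM => //.
    by apply: measurable_funB => //; exact: measurable_funX.
  exact: measurable_normal_pdf.
- by move=> x _; rewrite lee_fin normal_pdf_ge0.
- by apply: measurable_funTS; apply/measurable_EFinP; exact: measurable_normal_pdf.
Qed.

(** * Moments of the standard normal law *)

Lemma ge0_integral_oppr (R : realType) (f : R -> \bar R) :
  measurable_fun [set: R] f -> (forall x, (0 <= f x)%E) ->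
  (\int[@lebesgue_measure R]_x f (- x)%R = \int[@lebesgue_measure R]_x f x)%E.
Proof.
move=> mf f0.
pose g : measurableTypeR R -> measurableTypeR R := -%R.
have mg : measurable_fun [set: measurableTypeR R] g by exact: oppr_measurable.
have := @ge0_integral_pushforward _ _ _ _ R g mg lebesgue_measure setT f
  measurableT mf (fun y _ => f0 y).
rewrite preimage_setT => <-.
by apply: eq_measure_integral => A mA _; exact: lebesgue_measureN.
Qed.

(* [(1 - x ^+ 2) * phi x] is the derivative of [x * phi x], so its integrals
   over [0, 1] and [1, +oo[ are [phi 1] and [- phi 1]. *)
Lemma integral_sqr_std_normal_pdf (R : realType) :
  (\int[@lebesgue_measure R]_x (x ^+ 2 * normal_pdf 0 1 x)%:E = 1)%E.
Proof.
pose p : R -> R := normal_pdf 0 1.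
have cp : continuous p by apply: continuous_normal_pdf; rewrite oner_eq0.
have p0 x : 0 <= p x by exact: normal_pdf_ge0.
have csq : continuous (fun x : R => x ^+ 2 * p x).
  by move=> x; apply: cvgM; [exact: sqr_continuous|exact: cp].
(* The value 1 is read as the total mass of the density; both integrands are even, so they are
   compared on the half-line. *)
rewrite -(integral_normal_pdf (0 : R) 1).
have ep : p =1 p \o -%R by move=> x; rewrite /= /p std_normal_pdfN.
have esq : (fun x : R => x ^+ 2 * p x) =1 (fun x : R => x ^+ 2 * p x) \o -%R.
  by move=> x; rewrite /= sqrrN [in LHS](ep x).
have sq0 x : 0 <= x ^+ 2 * p x by rewrite mulr_ge0// sqr_ge0.
rewrite (ge0_symfun_integralT sq0 csq esq) (ge0_symfun_integralT p0 cp ep).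
congr (_ * _)%E.
(* The cut is at 1, where [x^2 - 1] changes sign: beyond it the tail integral of a nonnegative
   function applies, before it the fundamental theorem on a bounded interval. *)
have split (f : R -> R) : (forall x, 0 <= f x) -> continuous f ->
    (\int[@lebesgue_measure R]_(x in [set x | (0 <= x)%R]) (f x)%:E =
     \int[@lebesgue_measure R]_(x in `[0%R, 1%R]) (f x)%:E +
     \int[@lebesgue_measure R]_(x in `[1%R, +oo[) (f x)%:E)%E.
  move=> f0 cf; have mf : measurable_fun setT f by exact: continuous_measurable_fun.
  rewrite -(@integral_itv_obnd_cbnd _ 1); last exact/measurable_EFinP/measurable_funTS.
  rewrite -ge0_integral_setU//=.
  - congr (integral _ _ _); apply/seteqP; split => x /=; rewrite !in_itv/= !andbT.
      by move=> x0; case: (leP x 1) => x1; [left; rewrite x0|right].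
    by case => [/andP[]//|/ltW/(le_trans ler01)].
  - exact/measurable_EFinP/measurable_funTS.
  - by move=> x _; rewrite lee_fin.
  - apply/disj_setPS => x /=; rewrite !in_itv/= andbT => -[/andP[_ x1]].
    by rewrite ltNge x1.
rewrite (split _ sq0 csq) (split _ p0 cp) integral_sqr_std_normal_tail//.
rewrite addeA mul1r; congr (_ + _)%E.
have cf x : {for x, continuous (fun x : R => (1 - x ^+ 2) * p x)}.
  apply: cvgM; last exact: cp.
  by apply: cvgB; [exact: cvg_cst|exact: sqr_continuous].
have dF (x : R) : is_derive x 1 (id * p : R -> R) ((1 - x ^+ 2) * p x).
  have px := is_derive_std_normal_pdf x.
  by apply: is_derive_eq; rewrite /GRing.scale/= -/p; ring.
have <- : (\int[@lebesgue_measure R]_(x in `[0%R, 1%R]) ((1 - x ^+ 2) * p x)%:E =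
    (normal_pdf 0 1 1)%:E)%E.
  rewrite (@continuous_FTC2 _ _ (id * p) 0 1)//.
  - by rewrite -EFinB !fctE mul0r mul1r subr0.
  - exact: continuous_subspaceT.
  - have cF (x : R) : {for x, continuous (id * p : R -> R)}.
      by apply: differentiable_continuous; apply/derivable1_diffP; have [] := dF x.
    split.
    + by move=> x _; have [] := dF x.
    + exact: cvg_at_right_filter (cF _).
    + exact: cvg_at_left_filter (cF _).
  - by move=> x _; have dFx := dF x; rewrite derive1E derive_val.
rewrite -ge0_integralD//=.
- by apply: eq_integral => x _; rewrite -EFinD; congr EFin; ring.
- by move=> x _; rewrite lee_fin mulr_ge0// sqr_ge0.
- by apply/measurable_EFinP; apply: measurable_funTS; exact: continuous_measurable_fun.
- move=> x; rewrite /= in_itv/= => /andP[x0 x1].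
  by rewrite lee_fin mulr_ge0// subr_ge0 expr_le1.
- by apply/measurable_EFinP; apply: measurable_funTS; exact: continuous_measurable_fun.
Qed.

Lemma Lfun2_sqr_integral (R : realType) d (T : measurableType d)
    (mu : {measure set T -> \bar R}) (f : {mfun T >-> R}) :
  (\int[mu]_w (f w ^+ 2)%:E < +oo)%E -> (f : T -> R) \in Lfun mu 2%:E.
Proof.
move=> fy; rewrite inE; apply/andP; split; rewrite inE//=.
rewrite /finite_norm unlock poweR_lty//.
under eq_integral do rewrite /= powR_mulrn// real_normK// ?num_real//.
exact: fy.
Qed.

Section standard_normal_moments.
Variables (R : realType) (d : measure_display) (T : measurableType d).
Variables (P : probability T R) (X : {RV P >-> R}).
Hypothesis nX : standard_normal P X.

Lemma standard_normal_sqr : (\int[P]_w (X w ^+ 2)%:E = 1)%E.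
Proof.
have msq : measurable_fun [set: R] (fun x : R => (x ^+ 2)%:E).
  by apply/measurable_EFinP; exact: measurable_funX.
rewrite (ge0_integral_standard_normal nX msq); last first.
  by move=> x; rewrite lee_fin sqr_ge0.
rewrite ge0_integral_normal_prob//; last by move=> x; rewrite lee_fin sqr_ge0.
rewrite -[RHS]integral_sqr_std_normal_pdf.
by apply: eq_integral => x _; rewrite -EFinM.
Qed.

Lemma standard_normal_Lfun2 : (X : T -> R) \in Lfun P 2%:E.
Proof. by apply: Lfun2_sqr_integral; rewrite standard_normal_sqr ltry. Qed.

(** The density is even, so the positive and negative parts have the same integral; the second
    moment makes that integral finite, so the difference is 0. *)
Lemma standard_normal_expectation : ('E_P[X] = 0)%E.
Proof.
have X1 : (X : T -> R) \in Lfun P 1.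
  by apply: Lfun_subset12; [exact: fin_num_measure|exact: standard_normal_Lfun2].
have iX : P.-integrable setT (EFin \o X) by exact/Lfun1_integrable.
rewrite unlock integralE.
pose g (x : R) : \bar R := (Num.max x 0)%:E.
have g0 x : (0 <= g x)%E by rewrite lee_fin le_max lexx orbT.
have mg : measurable_fun [set: R] g.
  by apply/measurable_EFinP; exact: measurable_maxr.
have mgN : measurable_fun [set: R] (fun x => g (- x)).
  by apply: (measurableT_comp mg); exact: oppr_measurable.
have -> : ((fun w => (X w)%:E)^\+)%E = (fun w => g (X w)).
  by apply/funext => w; rewrite funeposE -EFin_max.
have -> : ((fun w => (X w)%:E)^\-)%E = (fun w => g (- X w)).
  by apply/funext => w; rewrite funenegE -EFinN -EFin_max.
have E1 := ge0_integral_standard_normal nX mg g0.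
have E2 := ge0_integral_standard_normal nX mgN (fun x => g0 _).
have E12 : (\int[P]_w g (X w) = \int[P]_w g (- X w)%R)%E.
  rewrite E1 E2 !ge0_integral_normal_prob// -ge0_integral_oppr//.
  - by apply: eq_integral => x _; rewrite std_normal_pdfN.
  - apply: emeasurable_funM => //; apply/measurable_EFinP.
    exact: measurable_normal_pdf.
  - by move=> x; rewrite mule_ge0// lee_fin normal_pdf_ge0.
rewrite -E12 subee//.
have := integrable_funepos measurableT iX.
have -> : ((EFin \o X)^\+)%E = (fun w => g (X w)).
  by apply/funext => w; rewrite funeposE -EFin_max.
by move=> /(integrable_fin_num measurableT).
Qed.

Lemma standard_normal_variance : ('V_P[X] = 1)%E.
Proof.
rewrite varianceE ?standard_normal_Lfun2// standard_normal_expectation.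
by rewrite expe2 mule0 sube0 unlock -standard_normal_sqr.
Qed.

End standard_normal_moments.

(** * Correlation of affine combinations *)

(** A variance is a covariance of a variable with itself, so this one bilinear identity yields all
    three entries of a correlation. *)
Lemma covariance_affine (R : realType) d (T : measurableType d)
    (P : probability T R) (X Y : T -> R) (a b c a' b' c' : R) :
  X \in Lfun P 2%:E -> Y \in Lfun P 2%:E ->
  (covariance P X Y = 0)%E -> ('V_P[Y] = 1)%E ->
  fine (covariance P (fun w => a + b * X w + c * Y w)
                     (fun w => a' + b' * X w + c' * Y w)) =
  b * b' * fine 'V_P[X] + c * c'.
Proof.
move=> X2 Y2 XY0 VY1.
have fP : P setT \is a fin_num by exact: fin_num_measure.
have L1 (f : T -> R) : f \in Lfun P 2%:E -> f \in Lfun P 1 by exact: Lfun_subset12.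
have LZ (k : R) (f : T -> R) : f \in Lfun P 2%:E -> (k \o* f)%R \in Lfun P 2%:E.
  by move=> f2; apply: Lfun_scale => //; rewrite ler1n.
have LM (f g : T -> R) : f \in Lfun P 2%:E -> g \in Lfun P 2%:E ->
    (f * g)%R \in Lfun P 1 by exact: Lfun2_mul_Lfun1.
have covZl (k : R) (f g : T -> R) : f \in Lfun P 2%:E -> g \in Lfun P 2%:E ->
    covariance P (k \o* f)%R g = (k%:E * covariance P f g)%E.
  by move=> f2 g2; rewrite covarianceZl//; [exact: L1|exact: L1|exact: LM].
have combE (i j k : R) : (fun w => i + j * X w + k * Y w) =
    (cst i \+ ((j \o* X) \+ (k \o* Y)))%R.
  by apply/funext => w /=; rewrite addrA !(mulrC (X w)) !(mulrC (Y w)).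
have LD (f g : T -> R) : f \in Lfun P 2%:E -> g \in Lfun P 2%:E ->
    (f \+ g)%R \in Lfun P 2%:E.
  by move=> f2 g2; rewrite rpredD ?lee1n.
have Lc (k : R) : (cst k : T -> R) \in Lfun P 2%:E by exact: Lfun_cst.
have covl (i j k : R) (g : T -> R) : g \in Lfun P 2%:E ->
    covariance P (fun w => i + j * X w + k * Y w) g =
    (j%:E * covariance P X g + k%:E * covariance P Y g)%E.
  move=> g2; rewrite combE covarianceDl ?LD ?LZ// covariance_cst_l add0e.
  by rewrite covarianceDl ?LZ// !covZl.
have L2 (i j k : R) : (fun w => i + j * X w + k * Y w) \in Lfun P 2%:E.
  by rewrite combE LD// LD ?LZ.
rewrite covl//; rewrite !(covarianceC _ _ (fun w => a' + _ + _)) !covl//.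
rewrite (covarianceC _ Y X) XY0 !mule0 adde0 add0e.
rewrite -!/('V_P[_])%E VY1 mule1.
have vfin : 'V_P[X]%E \is a fin_num by exact: variance_fin_num.
by rewrite -(fineK vfin) -!EFinM -EFinD /= mulrA.
Qed.

Lemma correlation_affine (R : realType) d (T : measurableType d)
    (P : probability T R) (X Y : T -> R) (a b c a' b' : R) :
  X \in Lfun P 2%:E -> Y \in Lfun P 2%:E ->
  (covariance P X Y = 0)%E -> ('V_P[Y] = 1)%E ->
  correlation P (fun w => a + b * X w + c * Y w) (fun w => a' + b' * X w) =
  b * b' * fine 'V_P[X] /
    Num.sqrt ((b ^+ 2 * fine 'V_P[X] + c ^+ 2) * (b' ^+ 2 * fine 'V_P[X])).
Proof.
move=> X2 Y2 XY0 VY1; rewrite /correlation.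
have -> : (fun w => a' + b' * X w) = (fun w => a' + b' * X w + 0 * Y w).
  by apply/funext => w; rewrite mul0r addr0.
by rewrite /variance !covariance_affine// !mulr0 !addr0 -!expr2 -/(variance P X).
Qed.

(** * Conditioning on an upper tail *)

Section conditioned_on_tail.
Variables (R : realType) (d : measure_display) (T : measurableType d).
Variables (P : probability T R) (M : {RV P >-> R}) (m al : R).
Hypothesis al_gt0 : 0 < al.
Hypothesis PM : P [set w | m <= M w] = al%:E.

Let Q := tail_probability P M m.
Let A := [set w | m <= M w].
Let mA : measurable A := measurable_upper_tail M m.

Lemma tail_probabilityE (S : set T) : Q S = (P (S `&` A) * al^-1%:E)%E.
Proof.
rewrite /Q /tail_probability /cond_probability /= /mnormalize /= /mrestr setTI PM.
(* Since [al] is not 0, the default branch of [mnormalize] is excluded. *)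
by rewrite eqe gt_eqF.
Qed.

(** The conditional measure vanishes off [A], and on subsets of [A] it is [P] scaled by [al^-1]. *)
Lemma ge0_integral_tail_probability (f : T -> \bar R) :
  measurable_fun [set: T] f -> (forall w, (0 <= f w)%E) ->
  (\int[Q]_w f w = al^-1%:E * \int[P]_(w in A) f w)%E.
Proof.
move=> mf f0.
have al_ge0 : 0 <= al^-1 by rewrite invr_ge0 ltW.
rewrite -(setUv A) ge0_integral_setU//; last 3 first.
- exact: measurableC.
- by rewrite setUv.
- exact/disj_setPCl.
rewrite [X in (_ + X)%E](_ : _ = 0)%E ?adde0.
  rewrite -(@ge0_integral_mscale _ _ _ P _ mA (NngNum al_ge0))//; last first.
    exact: measurable_funTS.
  apply: eq_measure_integral => S mS SA.
  by etransitivity; [exact: tail_probabilityE|rewrite setIidl// muleC].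
apply: null_set_integral => //; first exact: measurableC.
  exact: measurable_funTS.
by etransitivity; [exact: tail_probabilityE|rewrite setICl measure0 mul0e].
Qed.

End conditioned_on_tail.

Section gaussian_conditioned_on_tail.
Variables (R : realType) (d : measure_display) (T : measurableType d).
Variables (P : probability T R) (M U V : {RV P >-> R}) (m t al : R).
Hypothesis al_gt0 : 0 < al.
Hypothesis PM : P [set w | m <= M w] = al%:E.
Hypothesis MU : forall w, (m <= M w) = (t <= U w).
Hypothesis (nU : standard_normal P U) (nV : standard_normal P V).
Hypothesis UV : independent_RV2 P U V.

Let Q := tail_probability P M m.

Let event_tail : [set w | m <= M w] = U @^-1` `[t, +oo[.
Proof. by apply/seteqP; split => w /=; rewrite in_itv/= andbT MU. Qed.

Lemma normal_prob_tail : normal_prob 0 1 `[t, +oo[ = al%:E.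
Proof. by rewrite -PM event_tail -nU. Qed.

Lemma ge0_integral_tail_standard_normal (f : R -> \bar R) :
  measurable_fun [set: R] f -> (forall x, (0 <= f x)%E) ->
  (\int[Q]_w f (U w) = al^-1%:E *
    \int[@lebesgue_measure R]_(x in `[t, +oo[) (f x * (normal_pdf 0 1 x)%:E))%E.
Proof.
move=> mf f0.
rewrite (ge0_integral_tail_probability al_gt0 PM)//; last first.
  exact: (measurableT_comp mf).
congr (_ * _)%E; rewrite event_tail.
rewrite [LHS]integral_mkcond -ge0_integral_normal_prob// [RHS]integral_mkcond.
have mft : measurable_fun [set: R] (f \_ `[t, +oo[).
  by apply/(measurable_restrictT _ _).1 => //; exact: measurable_funTS.
rewrite -(ge0_integral_standard_normal nU mft); last first.
  by move=> x; rewrite patchE; case: ifP.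
by apply: eq_integral => w _; rewrite !patchE.
Qed.

(** The conditioning event is a preimage under [U]; by independence its probability factors out and
    cancels against [al^-1]. *)
Lemma standard_normal_tail_probability : standard_normal Q V.
Proof.
move=> B mB.
etransitivity; first exact: (tail_probabilityE al_gt0 PM).
rewrite setIC event_tail UV//.
have -> : P (U @^-1` `[t, +oo[) = al%:E by rewrite -event_tail PM.
have -> : P (V @^-1` B) = normal_prob 0 1 B by exact: nV.
by rewrite muleC muleA -EFinM mulVf ?gt_eqF// mul1e.
Qed.

(** Intersecting the conditioning event with a preimage under [U] gives another preimage under [U],
    to which the original independence applies. *)
Lemma independent_tail_probability : independent_RV2 Q U V.
Proof.
move=> B C mB mC.
have QE S : Q S = (P (S `&` [set w | (m <= M w)%R]) * al^-1%:E)%E.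
  exact: (tail_probabilityE al_gt0 PM).
have -> : Q (V @^-1` C) = P (V @^-1` C).
  by have := standard_normal_tail_probability mC; rewrite -nV.
rewrite !QE event_tail setIAC -setIA setIA -preimage_setI UV//; last exact: measurableI.
by rewrite muleAC.
Qed.

Lemma covariance_tail_probability : (U : T -> R) \in Lfun Q 2%:E ->
  (covariance Q U V = 0)%E.
Proof.
move=> U2.
have V2 := standard_normal_Lfun2 standard_normal_tail_probability.
have fP : Q setT \is a fin_num by exact: fin_num_measure.
have U1 := Lfun_subset12 fP U2.
have V1 := Lfun_subset12 fP V2.
have UV1 := Lfun2_mul_Lfun1 U2 V2.
rewrite covarianceE// (expectationM_independent independent_tail_probability)//.
by rewrite subee// fin_numM// expectation_fin_num.
Qed.

Hypothesis t_ge1 : 1 <= t.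

Lemma tail_sqr_expectation :
  (\int[Q]_w (U w ^+ 2)%:E = (1 + t * (normal_pdf 0 1 t / al))%:E)%E.
Proof.
rewrite (@ge0_integral_tail_standard_normal (fun x => (x ^+ 2)%:E)); last 2 first.
- by apply/measurable_EFinP; exact: measurable_funX.
- by move=> x; rewrite lee_fin sqr_ge0.
under eq_integral do rewrite -EFinM.
rewrite integral_sqr_std_normal_tail// normal_prob_tail -EFinD -EFinM.
by congr EFin; field; rewrite gt_eqF.
Qed.

Lemma tail_Lfun2 : (U : T -> R) \in Lfun Q 2%:E.
Proof. by apply: Lfun2_sqr_integral; rewrite tail_sqr_expectation ltry. Qed.

Lemma tail_expectation : ('E_Q[U] = (normal_pdf 0 1 t / al)%:E)%E.
Proof.
have t0 : 0 <= t by rewrite (le_trans _ t_ge1).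
have mg : measurable_fun [set: R] (fun x : R => (Num.max x 0)%:E).
  by apply/measurable_EFinP; exact: measurable_maxr.
have mgN : measurable_fun [set: R] (fun x : R => (Num.max (- x) 0)%:E).
  by apply: (measurableT_comp mg); exact: oppr_measurable.
rewrite unlock integralE.
have -> : ((fun w => (U w)%:E)^\+)%E = (fun w => (Num.max (U w) 0)%:E).
  by apply/funext => w; rewrite funeposE -EFin_max.
have -> : ((fun w => (U w)%:E)^\-)%E = (fun w => (Num.max (- U w) 0)%:E).
  by apply/funext => w; rewrite funenegE -EFinN -EFin_max.
rewrite (ge0_integral_tail_standard_normal mg); last first.
  by move=> x; rewrite lee_fin le_max lexx orbT.
rewrite (ge0_integral_tail_standard_normal mgN); last first.
  by move=> x; rewrite lee_fin le_max lexx orbT.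
(* The negative part contributes nothing, since the conditioned variable is at least [t >= 0]. *)
rewrite [X in (_ - _ * X)%E]integral0_eq; last first.
  move=> x; rewrite /= in_itv/= andbT => tx.
  by rewrite max_r ?mul0e// oppr_le0 (le_trans t0).
rewrite mule0 sube0.
rewrite (_ : integral _ _ _ = (normal_pdf 0 1 t)%:E).
  by rewrite -EFinM mulrC.
rewrite -integral_id_std_normal_tail//; apply: eq_integral => x.
rewrite inE/= in_itv/= andbT => tx.
by rewrite max_l -?EFinM// (le_trans t0).
Qed.

Lemma tail_variance :
  fine 'V_Q[U]%E = 1 + t * (normal_pdf 0 1 t / al) - (normal_pdf 0 1 t / al) ^+ 2.
Proof.
rewrite varianceE ?tail_Lfun2// tail_expectation.
rewrite [X in (X - _)%E](_ : _ = (1 + t * (normal_pdf 0 1 t / al))%:E)%E.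
  by rewrite -EFin_expe -EFinB.
by rewrite unlock -tail_sqr_expectation.
Qed.

End gaussian_conditioned_on_tail.

(** * Expansion of Mills' ratio *)

Definition std_normal_tail (R : realType) (t : R) : R :=
  fine (normal_prob 0 1 `[t, +oo[).

Lemma std_normal_tailE (R : realType) (t : R) :
  (std_normal_tail t)%:E = normal_prob 0 1 `[t, +oo[.
Proof. by rewrite fineK// fin_num_measure. Qed.

Lemma is_derive_invr (R : realType) (x : R) : x != 0 ->
  is_derive x 1 (GRing.inv : R -> R) (- x^-1 ^+ 2).
Proof.
move=> x0; apply: DeriveDef; first exact: (@derivableV _ _ id).
rewrite (@deriveV _ _ id)// derive_id.
by rewrite /GRing.scale/= mulr1 exprVn.
Qed.

(* With [r] a truncation of the asymptotic series of Mills' ratio,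
   [x * r x - r' x] is 1 up to a remainder of known sign. *)
Lemma std_normal_tail_bounds (R : realType) (t : R) : 2 <= t ->
  (t^-1 - t^-1 ^+ 3 + 3 * t^-1 ^+ 5 - 15 * t^-1 ^+ 7) * normal_pdf 0 1 t
    <= std_normal_tail t <= (t^-1 - t^-1 ^+ 3 + 3 * t^-1 ^+ 5) * normal_pdf 0 1 t.
Proof.
move=> t2.
have gt0 x : t <= x -> 0 < x by move=> tx; rewrite (lt_le_trans _ tx)// (lt_le_trans _ t2).
have nz x : t <= x -> x != 0 by move=> /gt0; exact: lt0r_neq0.
have inv0 := @cvg_inv_pinfty R.
have phi0 := @std_normal_pdf_cvg0 R.
have xn0 n : x^-1 ^+ n.+1 @[x --> +oo] --> (0 : R).
  rewrite -[X in _ --> X](expr0n R n.+1).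
  by apply: (cvg_comp _ (fun y : R => y ^+ n.+1) inv0); exact: exprn_continuous.
(* One family serves both bounds: [x r - r'] equals [1 - 105 x^-8] for [k = 15] and [1 + 15 x^-6]
   for [k = 0]. *)
pose r (k : R) (x : R) := x^-1 - x^-1 ^+ 3 + 3 * x^-1 ^+ 5 - k * x^-1 ^+ 7.
pose dr (k : R) (x : R) :=
  - x^-1 ^+ 2 + 3 * x^-1 ^+ 4 - 15 * x^-1 ^+ 6 + 7 * k * x^-1 ^+ 8.
have rdr k x : t <= x -> is_derive x 1 (r k) (dr k x).
  move=> /nz x0; have dV := is_derive_invr x0.
  have -> : r k = (GRing.inv : R -> R) - (GRing.inv : R -> R) ^+ 3 +
      3 *: (GRing.inv : R -> R) ^+ 5 - k *: (GRing.inv : R -> R) ^+ 7.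
    by apply/funext => y.
  by apply: is_derive_eq; rewrite /GRing.scale/= /GRing.scale/= /dr; ring.
have cdr k x : t <= x -> {for x, continuous (dr k)}.
  move=> /nz x0.
  have cn n : {for x, continuous (fun y : R => y^-1 ^+ n)}.
    apply: (@cvg_comp _ _ _ GRing.inv (fun y : R => y ^+ n)); first exact: inv_continuous.
    exact: exprn_continuous.
  apply: cvgD; last by apply: cvgM; [exact: cvg_cst|exact: cn].
  apply: cvgB; last by apply: cvgM; [exact: cvg_cst|exact: cn].
  apply: cvgD; last by apply: cvgM; [exact: cvg_cst|exact: cn].
  by apply: cvgN; exact: cn.
have xr k x : t <= x -> x * r k x - dr k x = 1 + (15 - k) * x^-1 ^+ 6 - 7 * k * x^-1 ^+ 8.
  by move=> /nz x0; rewrite /r /dr; field.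
have lim k : r k x * normal_pdf 0 1 x @[x --> +oo] --> (0 : R).
  rewrite -[X in _ --> X](mulr0 (0 - 0 + 3 * 0 - k * 0)); apply: cvgM => //.
  apply: cvgB; last by apply: cvgM; [exact: cvg_cst|exact: xn0].
  apply: cvgD; last by apply: cvgM; [exact: cvg_cst|exact: xn0].
  by apply: cvgB => //; exact: xn0.
have y0 x : t <= x -> 0 <= x^-1 by move=> /gt0 x0; rewrite invr_ge0 ltW.
have y2 x : t <= x -> x^-1 ^+ 2 <= 4^-1.
  move=> tx; have x0 := gt0 _ tx; rewrite exprVn lef_pV2 ?posrE ?exprn_gt0//.
  by have := le_trans t2 tx; nra.
apply/andP; split.
  rewrite -lee_fin std_normal_tailE.
  apply: (@std_normal_tail_ge _ (r 15) (dr 15)) => //.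
  - exact: cdr.
  - move=> x tx; rewrite -subr_ge0 xr//.
    have /= := y2 _ tx; have := y0 _ tx; set y := x^-1 => y_0 y_2.
    (* Here [2 <= t] is used: [x^-8 <= 1 / 256] keeps [1 - 105 x^-8] nonnegative. *)
    have : (y ^+ 2) ^+ 4 <= 4^-1 ^+ 4 by rewrite lerXn2r// nnegrE// sqr_ge0.
    by rewrite -exprM => h; lra.
  - move=> x tx; rewrite xr//.
    have : 0 <= x^-1 ^+ 8 by rewrite exprn_ge0// y0.
    lra.
rewrite -lee_fin std_normal_tailE.
have -> : t^-1 - t^-1 ^+ 3 + 3 * t^-1 ^+ 5 = r 0 t by rewrite /r mul0r subr0.
apply: (@std_normal_tail_le _ (r 0) (dr 0)) => //.
- exact: cdr.
- move=> x tx; rewrite -subr_ge0 xr// mulr0 mul0r !subr0 addr_ge0// mulr_ge0//.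
  by rewrite exprn_ge0// y0.
- move=> x tx; rewrite xr// mulr0 mul0r !subr0 lerDl mulr_ge0//.
  by rewrite exprn_ge0// y0.
Qed.

(** * Asymptotics of the tail variance and of the logarithm of the tail *)

Section asymptotics.
Variable R : realType.
Implicit Types t x : R.

Let phi : R -> R := normal_pdf 0 1.
Let Q : R -> R := @std_normal_tail R.
(* [t] times Mills' ratio; it tends to 1. *)
Let p t := t * Q t / phi t.
Let y2 t := t^-1 ^+ 2.

Let inv0 : t^-1 @[t --> +oo] --> (0 : R).
Proof. exact: cvg_inv_pinfty. Qed.

Let y20 : y2 t @[t --> +oo] --> (0 : R).
Proof.
by rewrite -[X in _ --> X](mulr0 0); under eq_fun do rewrite /y2 expr2; exact: cvgM.
Qed.

(** Rescaled remainder of [p] after the terms [1 - t^-2]. Its limit 3 is the next coefficient, and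
    [pE] restates the expansion with this exact remainder, so that later steps are algebra and
    limits of products. *)
Let e t := (p t - 1 + y2 t) * t ^+ 4.

Let e_cvg : e t @[t --> +oo] --> (3 : R).
Proof.
apply: (@squeeze_cvgr _ _ _ _ (fun t => 3 - 15 * y2 t) (cst 3)).
- near=> t.
  have t2 : 2 <= t by near: t; exact: nbhs_pinfty_ge.
  have t0 : 0 < t by rewrite (lt_le_trans _ t2).
  have f0 : 0 < phi t by exact: std_normal_pdf_gt0.
  have /andP[] := std_normal_tail_bounds t2; rewrite -/phi -/Q => lo hi.
  rewrite -ler_pdivlMr// in lo; rewrite -ler_pdivrMr// in hi.
  have pE : p t = t * (Q t / phi t) by rewrite /p mulrA.
  have t5 : 0 <= t ^+ 5 by rewrite exprn_ge0// ltW.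
  have eE : e t = (Q t / phi t) * t ^+ 5 - t ^+ 4 + t ^+ 2.
    by rewrite /e pE /y2; set q := Q t / phi t; field; rewrite gt_eqF.
  apply/andP; split.
  - rewrite eE; have := ler_wpM2r t5 lo.
    have -> : (t^-1 - t^-1 ^+ 3 + 3 * t^-1 ^+ 5 - 15 * t^-1 ^+ 7) * t ^+ 5 =
      t ^+ 4 - t ^+ 2 + 3 - 15 * y2 t by rewrite /y2; field; rewrite gt_eqF.
    lra.
  - rewrite /= eE; have := ler_wpM2r t5 hi.
    have -> : (t^-1 - t^-1 ^+ 3 + 3 * t^-1 ^+ 5) * t ^+ 5 = t ^+ 4 - t ^+ 2 + 3.
      by field; rewrite gt_eqF.
    lra.
- rewrite -[X in _ --> X]subr0 -[X in _ - X](mulr0 15).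
  by apply: cvgB; [exact: cvg_cst|apply: cvgM; [exact: cvg_cst|exact: y20]].
- exact: cvg_cst.
Unshelve. all: by end_near. Qed.

Let pE t : t != 0 -> p t = 1 - y2 t + e t * y2 t ^+ 2.
Proof. by move=> t0; rewrite /e /y2; field. Qed.

Let p_cvg : p t @[t --> +oo] --> (1 : R).
Proof.
have h : (1 - y2 t + e t * y2 t ^+ 2) @[t --> +oo] --> (1 : R).
  rewrite [X in _ --> X](_ : 1 = 1 - 0 + 3 * (0 * 0)); last by rewrite !mulr0 subr0 addr0.
  apply: cvgD; first by apply: cvgB; [exact: cvg_cst|exact: y20].
  apply: cvgM; first exact: e_cvg.
  by under eq_fun do rewrite expr2; apply: cvgM; exact: y20.
apply: cvg_trans h; apply: near_eq_cvg; near=> t.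
by rewrite /= pE// gt_eqF//; near: t; exact: nbhs_pinfty_gt.
Unshelve. all: by end_near. Qed.

Let Q_gt0_near : \forall t \near +oo, 0 < Q t.
Proof.
near=> t.
have t0 : 0 < t by near: t; exact: nbhs_pinfty_gt.
have p0 : 0 < p t by near: t; apply: (cvgr_gt 1 p_cvg).
move: p0; rewrite /p pmulr_lgt0 ?invr_gt0 ?std_normal_pdf_gt0//.
by rewrite pmulr_rgt0.
Unshelve. all: by end_near. Qed.

Definition std_normal_tail_variance t : R :=
  1 + t * (normal_pdf 0 1 t / std_normal_tail t) -
  (normal_pdf 0 1 t / std_normal_tail t) ^+ 2.

Let v := std_normal_tail_variance.

Lemma std_normal_tail_variance_asymptotics :
  v t * t ^+ 2 @[t --> +oo] --> (1 : R).
Proof.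
(* N comes from [v t * t ^+ 2 = (p ^+ 2 * y2 + p - 1) / (y2 * p) ^+ 2] with
   [p = 1 - y2 + e * y2 ^+ 2] substituted, which cancels [y2 ^+ 2]. *)
pose N t := - 2 + e t + y2 t + 2 * (1 - y2 t) * e t * y2 t + e t ^+ 2 * y2 t ^+ 3.
have h : N t / (p t ^+ 2) @[t --> +oo] --> (1 : R).
  have -> : (1 : R) = (- 2 + 3 + 0 + 2 * (1 - 0) * 3 * 0 + 3 ^+ 2 * 0 ^+ 3) / 1 ^+ 2.
    by rewrite expr1n divr1; ring.
  have ce : e t @[t --> +oo] --> (3 : R) := e_cvg.
  have cX (f : R -> R) (l : R) n : f t @[t --> +oo] --> l -> f t ^+ n @[t --> +oo] --> l ^+ n.
    by move=> fl; apply: (cvg_comp _ (fun y : R => y ^+ n) fl); exact: exprn_continuous.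
  apply: cvgM; last by apply: cvgV; [rewrite expr1n oner_eq0|exact: (cX _ _ _ p_cvg)].
  apply: cvgD; last by apply: cvgM; [exact: cX|exact: (cX _ _ _ y20)].
  apply: cvgD; last first.
    apply: cvgM; last exact: y20.
    apply: cvgM => //; apply: cvgM; first exact: cvg_cst.
    by apply: cvgB; [exact: cvg_cst|exact: y20].
  apply: cvgD; last exact: y20.
  by apply: cvgD => //; exact: cvg_cst.
apply: cvg_trans h; apply: near_eq_cvg; near=> t.
have t0 : t != 0 by rewrite gt_eqF//; near: t; exact: nbhs_pinfty_gt.
have Q0 : Q t != 0 by rewrite gt_eqF//; near: t; exact: Q_gt0_near.
have f0 : phi t != 0 by rewrite gt_eqF// std_normal_pdf_gt0.
have p0 : p t != 0 by rewrite /p !mulf_neq0// invr_neq0.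
have fQ : phi t / Q t = t / p t by rewrite /p; field; rewrite t0 f0 Q0.
rewrite /v /std_normal_tail_variance -/phi -/Q fQ.
have -> : N t = (p t ^+ 2 * y2 t + p t - 1) / y2 t ^+ 2.
  by rewrite pE// /N /y2; field.
by rewrite /y2; field; rewrite t0 p0.
Unshelve. all: by end_near. Qed.

Lemma std_normal_tail_variance_cvg0 : v t @[t --> +oo] --> (0 : R).
Proof.
have h : v t * t ^+ 2 * y2 t @[t --> +oo] --> (0 : R).
  rewrite -[X in _ --> X](mulr0 1); apply: cvgM; last exact: y20.
  exact: std_normal_tail_variance_asymptotics.
apply: cvg_trans h; apply: near_eq_cvg; near=> t.
have t0 : t != 0 by rewrite gt_eqF//; near: t; exact: nbhs_pinfty_gt.
by rewrite /= /y2 exprVn mulfK// expf_neq0.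
Unshelve. all: by end_near. Qed.

Let ln_y2_cvg0 : ln t * y2 t @[t --> +oo] --> (0 : R).
Proof.
apply: (@squeeze_cvgr _ _ _ _ (cst 0) (fun t => t^-1)); [|exact: cvg_cst|exact: inv0].
near=> t.
have t1 : 1 <= t by near: t; exact: nbhs_pinfty_ge.
have t0 : 0 < t by rewrite (lt_le_trans _ t1).
apply/andP; split.
  by rewrite mulr_ge0 ?ln_ge0// exprn_ge0// invr_ge0 ltW.
have V0 : 0 <= t^-1 by rewrite invr_ge0 ltW.
rewrite /y2 expr2 mulrA ler_piMl// ler_pdivrMr// mul1r ltW//.
exact: ln_sublinear.
Unshelve. all: by end_near. Qed.

Let L t := ln (1 / Q t).

(** Solving the definition of [p] for the tail gives [Q t = normal_peak 1 * expR (- t^2 / 2) * p t /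
    t]. Among the logarithms of its factors only [t^2 / 2] has order [t^2]. *)
Let ln_tail_asymptotics : L t * y2 t @[t --> +oo] --> (2^-1 : R).
Proof.
have h : (2^-1 - (ln (normal_peak 1) + ln (p t)) * y2 t + ln t * y2 t)
    @[t --> +oo] --> (2^-1 : R).
  rewrite [X in _ --> X](_ : _ = 2^-1 - (ln (normal_peak 1) + ln 1) * 0 + 0);
    last by rewrite mulr0 subr0 addr0.
  apply: cvgD; last exact: ln_y2_cvg0.
  apply: cvgB; first exact: cvg_cst.
  apply: cvgM; last exact: y20.
  apply: cvgD; first exact: cvg_cst.
  by apply: (cvg_comp _ _ p_cvg); exact: continuous_ln.
apply: cvg_trans h; apply: near_eq_cvg; near=> t.
have t0 : 0 < t by near: t; exact: nbhs_pinfty_gt.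
have p0 : 0 < p t by near: t; apply: (cvgr_gt 1 p_cvg).
have c0 : 0 < normal_peak 1 :> R by rewrite normal_peak_gt0 ?oner_eq0.
have e0 := expR_gt0 (- t ^+ 2 / 2).
have QE : 1 / Q t = (normal_peak 1 * expR (- t ^+ 2 / 2) * p t / t)^-1.
  rewrite -normal_pdf_std_expE -/phi /p div1r; congr (_^-1).
  have f0 : 0 < phi t by exact: std_normal_pdf_gt0.
  by field; rewrite !gt_eqF.
rewrite /L QE; move: (normal_peak 1) (p t) c0 p0 {QE} => k q k0 q0.
rewrite lnV ?posrE ?divr_gt0 ?mulr_gt0// ln_div ?posrE ?mulr_gt0//.
rewrite lnM ?posrE ?mulr_gt0// lnM ?posrE// expRK.
by rewrite /y2; field; rewrite gt_eqF.
Unshelve. all: by end_near. Qed.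

(** The radicand in the theorem, which behaves like the square of the standardized quantile. *)
Definition log_tail_expansion (al : R) : R :=
  2 * ln (1 / al) - ln (ln (1 / al ^+ 2)) - ln (2 * pi).

(** The double logarithm is [ln (2 L)] with [L] of order [t^2], hence of order [ln t]; divided by
    [t^2], it vanishes together with the constant. *)
Lemma log_tail_expansion_asymptotics :
  log_tail_expansion (std_normal_tail t) / t ^+ 2 @[t --> +oo] --> (1 : R).
Proof.
have lnL : ln (2 * L t) * y2 t @[t --> +oo] --> (0 : R).
  apply: (@squeeze_cvgr _ _ _ _ (cst 0) (fun t => ln 2 * y2 t + 2 * (ln t * y2 t))).
  - near=> t.
    have t2 : 2 <= t by near: t; exact: nbhs_pinfty_ge.
    have t0 : 0 < t by rewrite (lt_le_trans _ t2).
    have y0 : 0 < y2 t by rewrite exprn_gt0// invr_gt0.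
    have y2t : y2 t * t ^+ 2 = 1 by rewrite /y2 exprVn mulVf// gt_eqF// exprn_gt0.
    (* Any bounds around the limit [1 / 2] would do. With [t >= 2] the lower one gives [2 L >= 1],
       so the logarithm is nonnegative; the upper one gives [2 L <= 2 t^2]. *)
    have lo : 4^-1 < L t * y2 t by near: t; apply: (cvgr_gt _ ln_tail_asymptotics); lra.
    have hi : L t * y2 t < 1 by near: t; apply: (cvgr_lt _ ln_tail_asymptotics); lra.
    have LE : L t = L t * y2 t * t ^+ 2 by rewrite -mulrA y2t mulr1.
    have L1 : 1 <= 2 * L t by rewrite LE; nra.
    have L2 : 2 * L t <= 2 * t ^+ 2 by rewrite LE; nra.
    apply/andP; split; first by rewrite mulr_ge0 ?ln_ge0// ltW.
    rewrite mulrA -mulrDl ler_pM2r//.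
    have -> : ln 2 + 2 * ln t = ln (2 * t ^+ 2).
      by rewrite lnM ?posrE ?exprn_gt0// lnXn// mulr_natl.
    have pL : 0 < 2 * L t by rewrite (lt_le_trans _ L1).
    have pt : 0 < 2 * t ^+ 2 by rewrite (lt_le_trans pL).
    by rewrite ler_ln ?posrE.
  - exact: cvg_cst.
  - rewrite [X in _ --> X](_ : _ = ln 2 * 0 + 2 * 0); last by rewrite !mulr0 addr0.
    apply: cvgD; apply: cvgM; [exact: cvg_cst|exact: y20|exact: cvg_cst|exact: ln_y2_cvg0].
have h : (2 * (L t * y2 t) - ln (2 * L t) * y2 t - ln (2 * pi) * y2 t)
    @[t --> +oo] --> (1 : R).
  rewrite [X in _ --> X](_ : _ = 2 * 2^-1 - 0 - ln (2 * pi) * 0); last by field.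
  apply: cvgB; last by apply: cvgM; [exact: cvg_cst|exact: y20].
  apply: cvgB => //; apply: cvgM; [exact: cvg_cst|exact: ln_tail_asymptotics].
apply: cvg_trans h; apply: near_eq_cvg; near=> t.
have Q0 : 0 < Q t by near: t; exact: Q_gt0_near.
rewrite /log_tail_expansion -/Q.
have -> : ln (1 / Q t ^+ 2) = 2 * L t.
  by rewrite /L -[1 in LHS](expr1n R 2) -expr_div_n lnXn ?divr_gt0// mulr_natl.
by rewrite -/(L t) /y2 exprVn; ring.
Unshelve. all: by end_near. Qed.

Lemma std_normal_tail_anti s t : s <= t -> Q t <= Q s.
Proof.
move=> st; rewrite -lee_fin !std_normal_tailE; apply: le_measure; rewrite ?inE//.
by move=> x /=; rewrite !in_itv/= !andbT; exact: le_trans.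
Qed.

(** Far out, positivity comes from [p] tending to 1; monotonicity carries it back to every [t]. *)
Lemma std_normal_tail_gt0 t : 0 < Q t.
Proof.
have [s [ts Qs]] : exists s, t <= s /\ 0 < Q s.
  near (+oo%R : set_system R) => s; exists s; split; near: s.
    by apply: nbhs_pinfty_ge; exact: num_real.
  exact: Q_gt0_near.
exact: lt_le_trans Qs (std_normal_tail_anti ts).
Unshelve. all: by end_near. Qed.

End asymptotics.

(** * Limits of the correlation as a function of the threshold *)

Section limits.
Variables (R : realType) (eps : R).
Hypothesis eps_gt0 : 0 < eps.

Let v := @std_normal_tail_variance R.
Let g t := Num.sqrt (v t) / Num.sqrt (v t + eps ^+ 2).

Let sqrt_denom_cvg : Num.sqrt (v t + eps ^+ 2) @[t --> +oo] --> eps.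
Proof.
rewrite [X in _ --> X](_ : eps = Num.sqrt (0 + eps ^+ 2));
  last by rewrite add0r sqrtr_sqr gtr0_norm.
apply: continuous_cvg; first exact: sqrt_continuous.
by apply: cvgD; [exact: std_normal_tail_variance_cvg0|exact: cvg_cst].
Qed.

Lemma tail_correlation_cvg0 : g t @[t --> +oo] --> (0 : R).
Proof.
rewrite [X in _ --> X](_ : _ = Num.sqrt 0 / eps); last by rewrite sqrtr0 mul0r.
apply: cvgM; last by apply: cvgV; [rewrite gt_eqF|exact: sqrt_denom_cvg].
apply: continuous_cvg; [exact: sqrt_continuous|exact: std_normal_tail_variance_cvg0].
Qed.

(** A factor [t] is moved from one root to the other: [sqrt (v t^2)] and the root of the radicand
    divided by [t^2] both tend to 1, and the two occurrences of [eps] cancel. *)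
Lemma tail_correlation_asymptotics :
  g t / (1 / (eps * Num.sqrt (log_tail_expansion (std_normal_tail t))))
    @[t --> +oo] --> (1 : R).
Proof.
have h : (Num.sqrt (v t * t ^+ 2) / Num.sqrt (v t + eps ^+ 2)) *
    (eps * Num.sqrt (log_tail_expansion (std_normal_tail t) / t ^+ 2))
    @[t --> +oo] --> (1 : R).
  rewrite [X in _ --> X](_ : _ = (Num.sqrt 1 / eps) * (eps * Num.sqrt 1));
    last by rewrite sqrtr1; field; rewrite gt_eqF.
  apply: cvgM; apply: cvgM.
  - apply: continuous_cvg; [exact: sqrt_continuous|exact: std_normal_tail_variance_asymptotics].
  - by apply: cvgV; [rewrite gt_eqF|exact: sqrt_denom_cvg].
  - exact: cvg_cst.
  - apply: continuous_cvg; [exact: sqrt_continuous|exact: log_tail_expansion_asymptotics].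
apply: cvg_trans h; apply: near_eq_cvg; near=> t.
have t0 : 0 < t by near: t; exact: nbhs_pinfty_gt.
have st : Num.sqrt (t ^+ 2) = t by rewrite sqrtr_sqr gtr0_norm.
have sti : Num.sqrt (t ^+ 2)^-1 = t^-1 by rewrite sqrtrV ?st// sqr_ge0.
(* [sqrtrM] asks for one nonnegative factor; choosing the power of [t] avoids any sign condition on
   [v] or on the radicand. *)
rewrite (mulrC (v t)) sqrtrM ?sqr_ge0// st.
rewrite (mulrC (log_tail_expansion _)) sqrtrM ?invr_ge0 ?sqr_ge0// sti.
rewrite /g div1r invrK; set E := _^-1.
by field; rewrite gt_eqF.
Unshelve. all: by end_near. Qed.

End limits.

(** * Reduction of the general case *)

Lemma normal_variance_affine (R : realType) d (T : measurableType d)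
    (P : probability T R) (X Z : {RV P >-> R}) (a s : R) :
  standard_normal P Z -> (forall w, X w = a + s * Z w) ->
  fine 'V_P[X]%E = s ^+ 2.
Proof.
move=> nZ XE; have Z2 := standard_normal_Lfun2 nZ.
have -> : (X : T -> R) = (cst a \+ (s \o* Z))%R.
  by apply/funext => w; rewrite XE /= mulrC.
rewrite varianceD_cst_l; last by apply: Lfun_scale => //; rewrite ler1n.
by rewrite varianceZ// standard_normal_variance// mule1.
Qed.

Lemma independent_RV2_affine (R : realType) d (T : measurableType d)
    (P : probability T R) (X Y Z W : {RV P >-> R}) (a b s t : R) :
  0 < s -> 0 < t -> independent_RV2 P X Y ->
  (forall w, X w = a + s * Z w) -> (forall w, Y w = b + t * W w) ->
  independent_RV2 P Z W.
Proof.
move=> s0 t0 ind XE YE A B mA mB.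
have pre (F H : T -> R) (c k : R) (C : set R) : 0 < k ->
    (forall w, F w = c + k * H w) -> H @^-1` C = F @^-1` ((fun x => (x - c) / k) @^-1` C).
  move=> k0 FE; apply/seteqP; split => w /=;
    by rewrite FE addrAC subrr add0r mulrAC divff ?gt_eqF// mul1r.
have mpre (c k : R) (C : set R) : measurable C ->
    measurable ((fun x => (x - c) / k) @^-1` C).
  move=> mC; rewrite -[X in measurable X]setTI.
  have mf : measurable_fun [set: R] (fun x : R => (x - c) / k).
    by apply: measurable_funM => //; exact: measurable_funB.
  exact: mf.
by rewrite (pre _ _ _ _ A s0 XE) (pre _ _ _ _ B t0 YE) ind//; exact: mpre.
Qed.

Theorem theorem2 (R : realType) (d : measure_display) (T : measurableType d)
    (P : probability T R) (eps : R) (G xi M : {RV P >-> R}) (m : R -> R)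
    (eps_gt0 : 0 < eps)
    (normalG : normally_distributed P G)
    (normalxi : normally_distributed P xi)
    (varG_gt0 : (0 < 'V_P[G])%E)
    (varxi_gt0 : (0 < 'V_P[xi])%E)
    (indep : independent_RV2 P G xi)
    (var_ratio : fine 'V_P[xi] / fine 'V_P[G] = eps ^+ 2)
    (ME : forall w, M w = G w + xi w)
    (quantile : top_quantile P M m) :
  let tau : R := 2 * pi in
  let rho (alpha : R) : R := correlation (tail_probability P M (m alpha)) G M in
  let f (alpha : R) : R :=
    1 / (eps * Num.sqrt (2 * ln (1 / alpha) - ln (ln (1 / alpha ^+ 2))
                         - ln tau)) in
  (rho alpha / f alpha @[alpha --> 0^'+] --> (1 : R)) /\
  (rho alpha @[alpha --> 0^'+] --> (0 : R)).
Proof.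
move=> tau rho f.
have [a [s1 [Z1 [s1_gt0 nZ1 GE]]]] := normally_distributed_standardize normalG.
have [b [s2 [Z2 [s2_gt0 nZ2 xiE]]]] := normally_distributed_standardize normalxi.
have Z12 := independent_RV2_affine s1_gt0 s2_gt0 indep GE xiE.
have epsE : eps = s2 / s1.
  move: var_ratio; rewrite (normal_variance_affine nZ1 GE) (normal_variance_affine nZ2 xiE).
  rewrite -expr_div_n => /esym/eqP; rewrite eqrXn2// ?ltW ?divr_gt0//.
  by move/eqP.
pose s := Num.sqrt (s1 ^+ 2 + s2 ^+ 2).
have s_gt0 : 0 < s by rewrite sqrtr_gt0 addr_gt0// exprn_gt0.
have s_sqr : s ^+ 2 = s1 ^+ 2 + s2 ^+ 2 by rewrite sqr_sqrtr// addr_ge0// sqr_ge0.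
(* [s] is the standard deviation of [M], so these weights make [U] the standardization of [M], with
   [e / c = s2 / s1 = eps]. *)
pose c := s1 / s; pose e := s2 / s.
have c_gt0 : 0 < c by rewrite divr_gt0.
have e_gt0 : 0 < e by rewrite divr_gt0.
have ce : c ^+ 2 + e ^+ 2 = 1.
  by rewrite !expr_div_n -mulrDl -s_sqr mulfV// expf_neq0// gt_eqF.
have [U UE] : exists U : {RV P >-> R}, forall w, U w = c * Z1 w + e * Z2 w.
  have mU : measurable_fun [set: T] (fun w => c * Z1 w + e * Z2 w).
    by apply: measurable_funD; apply: measurable_funM.
  by have [U UE] := exists_mfun mU; exists U => w; rewrite UE.
have [V VE] : exists V : {RV P >-> R}, forall w, V w = e * Z1 w - c * Z2 w.
  have mV : measurable_fun [set: T] (fun w => e * Z1 w - c * Z2 w).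
    by apply: measurable_funB; apply: measurable_funM.
  by have [V VE] := exists_mfun mV; exists V => w; rewrite VE.
have [nU nV UV] := std_normal_rotation ce e_gt0 nZ1 nZ2 Z12 UE VE.
have GUV : (G : T -> R) = (fun w => a + (s1 * c) * U w + (s1 * e) * V w).
  apply/funext => w; rewrite GE UE VE.
  transitivity (a + s1 * ((c ^+ 2 + e ^+ 2) * Z1 w)); last by ring.
  by rewrite ce mul1r.
have MU : (M : T -> R) = (fun w => (a + b) + s * U w).
  apply/funext => w; rewrite ME GE xiE UE /c /e.
  by field; rewrite gt_eqF.
pose t (al : R) := (m al - (a + b)) / s.
have MtU al w : (m al <= M w) = (t al <= U w).
  by rewrite MU ler_pdivrMr// lerBlDl (mulrC s).
have QtE al : 0 < al < 1 -> std_normal_tail (t al) = al.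
  move=> al01; have := quantile _ al01 => PM.
  by apply/EFin_inj; rewrite std_normal_tailE (normal_prob_tail PM (MtU al) nU).
(* If [t al <= K], then [al = Q (t al) >= Q K > 0], which fails for small [al]. *)
have t_cvg : t al @[al --> 0^'+] --> +oo.
  apply/cvgryPgt => K; near=> al.
  have al0 : 0 < al by near: al; exact: nbhs_right_gt.
  have al1 : al < 1 by near: al; exact: nbhs_right_lt.
  have alK : al < std_normal_tail K.
    by near: al; apply: nbhs_right_lt; exact: std_normal_tail_gt0.
  rewrite ltNge; apply/negP => tK.
  have := std_normal_tail_anti tK; rewrite QtE ?al0// => Kal.
  by move: (lt_le_trans alK Kal); rewrite ltxx.
pose v := @std_normal_tail_variance R.
have rhoE al : 0 < al < 1 -> 1 <= t al ->
    rho al = Num.sqrt (v (t al)) / Num.sqrt (v (t al) + eps ^+ 2).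
  move=> al01 t1; have PM := quantile _ al01; have al0 : 0 < al by case/andP: al01.
  have U2 := tail_Lfun2 al0 PM (MtU al) nU t1.
  have cov0 := covariance_tail_probability al0 PM (MtU al) nV UV U2.
  have V1 := standard_normal_variance
    (standard_normal_tail_probability al0 PM (MtU al) nV UV).
  have vE := tail_variance al0 PM (MtU al) nU t1.
  have v_ge0 : 0 <= v (t al).
    by rewrite /v /std_normal_tail_variance QtE// -vE fine_ge0// variance_ge0.
  have V2 := standard_normal_Lfun2
    (standard_normal_tail_probability al0 PM (MtU al) nV UV).
  rewrite /rho GUV MU correlation_affine// vE.
  have -> : 1 + t al * (normal_pdf 0 1 (t al) / al) - (normal_pdf 0 1 (t al) / al) ^+ 2 =
      v (t al) by rewrite /v /std_normal_tail_variance QtE.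
  (* Since [e = c eps], the scales factor out as one square, which cancels against the numerator. *)
  have -> : ((s1 * c) ^+ 2 * v (t al) + (s1 * e) ^+ 2) * (s ^+ 2 * v (t al)) =
      (s1 * c * s) ^+ 2 * ((v (t al) + eps ^+ 2) * v (t al)).
    by rewrite epsE /c /e; field; rewrite !gt_eqF.
  have k0 : 0 < s1 * c * s := mulr_gt0 (mulr_gt0 s1_gt0 c_gt0) s_gt0.
  have ve0 : 0 < v (t al) + eps ^+ 2 by rewrite ltr_wpDl// exprn_gt0.
  rewrite sqrtrM ?sqr_ge0// sqrtr_sqr gtr0_norm// sqrtrM ?ltW//.
  rewrite -{1}(sqr_sqrtr v_ge0).
  (* Only [v >= 0] is at hand; if its root is 0, both sides are 0. *)
  have [->|r0] := eqVneq (Num.sqrt (v (t al))) 0; first by rewrite expr0n !mulr0 !mul0r.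
  have d0 : Num.sqrt (v (t al) + eps ^+ 2) != 0 by rewrite gt_eqF// sqrtr_gt0.
  by field; rewrite r0 d0 !gt_eqF.
have near_rho : \forall al \near 0^'+, 0 < al < 1 /\ 1 <= t al.
  near=> al; split; last by near: al; move/cvgryPge : t_cvg; apply.
  by apply/andP; split; near: al; [exact: nbhs_right_gt|exact: nbhs_right_lt].
split.
- have := cvg_comp _ _ t_cvg (tail_correlation_asymptotics eps_gt0).
  apply: cvg_trans; apply: near_eq_cvg; near=> al.
  have [al01 t1] : 0 < al < 1 /\ 1 <= t al by near: al.
  by rewrite /= rhoE// QtE.
- have := cvg_comp _ _ t_cvg (tail_correlation_cvg0 eps_gt0).
  apply: cvg_trans; apply: near_eq_cvg; near=> al.
  have [al01 t1] : 0 < al < 1 /\ 1 <= t al by near: al.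
  by rewrite /= rhoE.
Unshelve. all: by end_near. Qed.
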